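(* Let $n\ge 1$ and let $X$ be a finite pure $n$-dimensional simplicial complex with connected links and with a balanced weight function $m$. Assume that $X$ is $(n+1)$-partite with sides $S_0,\dots,S_n$. Assume there is a constant $0<\lambda<1$ such that for every $0\le k\le n-1$ and every $\tau\in X(k-1)$, $\mathrm{Spec}((M')^+_{\tau,0})\subseteq[-1,\lambda]\cup\{1\}$. Then for all sets $U_0\subseteq S_0,\dots,U_n\subseteq S_n$, $$\left|\frac{m(X(U_0,\dots,U_n))}{m(X(n))}-\frac{m(U_0)\cdots m(U_n)}{m(S_0)\cdots m(S_n)}\right|\le C_n\lambda\min_{0\le i<j\le n}\sqrt{\frac{m(U_i)m(U_j)}{m(S_i)m(S_j)}},$$ where $$C_n=\sum_{k=0}^{n-1}n!\,\frac{(n+1-k)^{n-k}}{(n-k-1)!}\left((k+1)(k+2)^{n-k}-(k+1)^{n-k+1}\right).$$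
   Context: $X(k)$ denotes the set of simplices of $X$ with $k+1$ vertices, $X(-1)=\{\emptyset\}$; a vertex $v$ is identified with $\{v\}\in X(0)$. $X$ is pure $n$-dimensional if every simplex is contained in a simplex of $X(n)$. For $\tau\in X(k)$ the link $X_\tau$ is the complex with $\eta\in X_\tau(l)$ iff $\eta\in X(l)$ and $\tau\cup\eta\in X(k+l+1)$; $X_\emptyset=X$. ''Connected links'' means that for every $-1\le k\le n-2$ and every $\tau\in X(k)$ the one-skeleton of $X_\tau$ (the graph with vertices $X_\tau(0)$ and edges $X_\tau(1)$) is connected; in particular the one-skeleton of $X$ is connected. $X$ is $(n+1)$-partite with sides $S_0,\dots,S_n\subseteq X(0)$ if the $S_i$ are disjoint, $X(0)=\bigcup_i S_i$, and $|\sigma\cap S_i|=1$ for every $\sigma\in X(n)$ and every $0\le i\le n$. A balanced weight function is a function $m:\bigcup_{-1\le k\le n}X(k)\to\mathbb{R}^+$ (strictly positive) such that for every $-1\le k\le n-1$ and $\tau\in X(k)$, $m(\tau)=\sum_{\sigma\in X(k+1),\,\tau\subset\sigma}m(\sigma)$. For a set $U\subseteq X(k)$ of simplices, $m(U)=\sum_{\sigma\in U}m(\sigma)$. On the link, $m_\tau(\eta)=m(\tau\cup\eta)$. The weighted random walk operator $(M')^+_{\tau,0}$ acts on functions $\phi:X_\tau(0)\to\mathbb{R}$ by $$(M')^+_{\tau,0}\phi(v)=\sum_{u:\{u,v\}\in X_\tau(1)}\frac{m_\tau(\{u,v\})}{m_\tau(\{v\})}\phi(u).$$ For pairwise disjoint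 $U_0,\dots,U_n\subseteq X(0)$, $X(U_0,\dots,U_n)=\{\sigma\in X(n):|\sigma\cap U_i|=1\text{ for all }0\le i\le n\}$. *)

(* Defs.v *)
From HB Require Import structures.
From mathcomp Require Import all_boot all_order all_algebra.
From mathcomp Require Import reals.

Set Implicit Arguments.
Unset Strict Implicit.
Unset Printing Implicit Defensive.

Import Order.TTheory GRing.Theory Num.Theory.
Local Open Scope ring_scope.

(* A complex is the set of all its simplices, the empty one included.  The
   ambient type V may have elements that are not vertices of X.
   The dimension of s is #|s| - 1; hence a quantification over tau in X(k),
   -1 <= k <= d - 1, is rendered by tau \in X and (#|tau| <= d)%N. *)

Record simplicial_complex (V : finType) (X : {set {set V}}) : Prop := {
  complex_set0 : set0 \in X;
  complex_sub : forall s t : {set V}, s \in X -> t \subset s -> t \in X }.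

Section Complexes.
Variables (V : finType) (X : {set {set V}}).
Implicit Types (n k : nat) (s tau : {set V}).

(* X(k) for k >= 0 *)
Definition simplices k : {set {set V}} := [set s in X | #|s| == k.+1].

(* X(0), as a set of points of V *)
Definition vertices : {set V} := [set v | [set v] \in simplices 0].

Definition pure n : Prop :=
  forall s, s \in X -> exists2 t : {set V}, t \in simplices n & s \subset t.

(* The cardinality condition says that tau :|: eta has dimension k + l + 1
   when tau and eta have dimensions k and l. *)
Definition link tau : {set {set V}} :=
  [set eta in X | (tau :|: eta \in X) && (#|tau :|: eta| == #|tau| + #|eta|)%N].

Definition partite n (S : 'I_n.+1 -> {set V}) : Prop :=
  [/\ forall i j, i != j -> [disjoint S i & S j],
      vertices = \bigcup_i S i
    & forall s, s \in simplices n -> forall i, #|s :&: S i| = 1%N].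

(* X(U_0, ..., U_n) *)
Definition transversals n (U : 'I_n.+1 -> {set V}) : {set {set V}} :=
  [set s in simplices n | [forall i, #|s :&: U i| == 1%N]].

End Complexes.

Definition one_skeleton (V : finType) (Y : {set {set V}}) : rel V :=
  fun u v => [set u; v] \in simplices Y 1.

Definition connected_one_skeleton (V : finType) (Y : {set {set V}}) : Prop :=
  {in vertices Y &, forall u v, connect (one_skeleton Y) u v}.

Definition connected_links (V : finType) (X : {set {set V}}) (n : nat) : Prop :=
  forall tau, tau \in X -> (#|tau| < n)%N -> connected_one_skeleton (link X tau).

Section Weights.
Variables (R : realType) (V : finType) (X : {set {set V}}) (m : {set V} -> R).

(* Since dim tau = #|tau| - 1, the simplices one dimension above tau are
   those of simplices X #|tau|. *)
Definition balanced_weight (n : nat) : Prop :=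
  (forall s, s \in X -> 0 < m s) /\
  (forall tau, tau \in X -> (#|tau| <= n)%N ->
     m tau = \sum_(s in simplices X #|tau| | tau \subset s) m s).

Definition mass (A : {set {set V}}) : R := \sum_(s in A) m s.

Definition vertex_mass (U : {set V}) : R := mass [set [set v] | v in U].

Variable tau : {set V}.

Definition link_weight (eta : {set V}) : R := m (tau :|: eta).

(* X_tau(0) as a type *)
Definition link_vertex : finType := {v : V | v \in vertices (link X tau)}.

Definition upper_walk (phi : {ffun link_vertex -> R^o}) :
    {ffun link_vertex -> R^o} :=
  [ffun v : link_vertex =>
    \sum_(u : link_vertex | [set val u; val v] \in simplices (link X tau) 1)
      link_weight [set val u; val v] / link_weight [set val v] * phi u].

Fact upper_walk_is_linear : linear upper_walk.
Proof.
move=> a f g; apply/ffunP => v; rewrite !ffunE scaler_sumr -big_split /=.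
by apply: eq_bigr => u _; rewrite !ffunE mulrDr mulrCA.
Qed.

HB.instance Definition _ := GRing.isLinear.Build R
  {ffun link_vertex -> R^o} {ffun link_vertex -> R^o} _
  upper_walk upper_walk_is_linear.

(* The real eigenvalues are the whole spectrum: the walk is self-adjoint for
   the inner product weighted by link_weight, as m is positive on X. *)
Definition upper_walk_spectrum : pred R :=
  passmx.leigenvalue (linfun upper_walk).

Lemma upper_walk_spectrumP (mu : R) :
  reflect (exists2 phi, phi != 0 & upper_walk phi = mu *: phi)
          (mu \in upper_walk_spectrum).
Proof.
pose f := linfun upper_walk - mu *: \1%VF.
have fE phi : f phi = upper_walk phi - mu *: phi.
  by rewrite add_lfunE opp_lfunE scale_lfunE id_lfunE lfunE.
apply: (iffP idP) => [f_ker|[phi phi_neq0 phi_eigen]].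
  exists (vpick (lker f)); first by rewrite vpick0.
  by apply/eqP; rewrite -subr_eq0 -fE -memv_ker memv_pick.
apply: contraNneq phi_neq0 => f_ker.
by rewrite -memv0 -f_ker memv_ker fE phi_eigen subrr.
Qed.

End Weights.

Section Bound.
Variable R : realType.

(* The minimum of F i j over i < j.  The initial value is F at the pair
   (0, n), which satisfies i < j when n >= 1. *)
Definition min_pairs (n : nat) (F : 'I_n.+1 -> 'I_n.+1 -> R) : R :=
  \big[Num.min/F ord0 ord_max]_(p : 'I_n.+1 * 'I_n.+1 | (p.1 < p.2)%N)
    F p.1 p.2.

Definition mixing_const (n : nat) : R :=
  \sum_(k < n)
    n`!%:R * ((n + 1 - k)%:R ^+ (n - k) / (n - k - 1)`!%:R) *
    ((k + 1)%:R * (k + 2)%:R ^+ (n - k) - (k + 1)%:R ^+ (n - k + 1)).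

End Bound.

(* Main.v *)
Require Import Defs.
From mathcomp Require Import boolp classical_sets reals topology normedtype derive.
From mathcomp Require Import all_boot all_order all_algebra.
From mathcomp Require Import ring lra zify.

Set Implicit Arguments.
Unset Strict Implicit.
Unset Printing Implicit Defensive.

Import Order.TTheory GRing.Theory Num.Theory.
Import numFieldNormedType.Exports.
Local Open Scope ring_scope.

(* Choose a facet s with probability proportional to m s, and let x_i be its
   vertex in S_i.  The claim compares P(x_i in U_i for all i) with the product
   of the P(x_i in U_i).

   The spectral gap of the link of tau, tested on a function supported on two
   sides S_i and S_j, says that functions of x_i and of x_j have correlation at
   most (n - |tau|) lambda conditionally on tau being a face of s.  Hence the
   event x_i in U_i and an event A depending on the vertices of sides
   j_1, ..., j_r other than S_i satisfy
     |Cov| <= n r lambda sqrt(P(x_i in U_i) P(A)) :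
   condition on x_(j_1), treat the conditional covariance by induction in the
   link of x_(j_1), and the covariance of the conditional expectations by the
   bound for pairs.  The induction carries the weighted form
     |Cov| <= n r lambda (t P(x_i in U_i) + P(A) / t) / 2 for every t > 0,
   which, unlike the one with the square root, can be summed over x_(j_1).

   Splitting off one side after the other, beginning with S_i and S_j, bounds
   the deviation by n^2 (n + 1) lambda sqrt(P(x_i in U_i) P(x_j in U_j)), and
   n^2 (n + 1) is at most the k = 0 term of mixing_const. *)

(** * Rayleigh quotients of a symmetric form relative to a positive diagonal form *)

Section Spectral.
Variable R : realType.

Lemma continuous_sum (T : topologicalType) (I : Type) (r : seq I)
    (F : I -> T -> R) :
  (forall i, continuous (F i)) -> continuous (fun x => \sum_(i <- r) F i x).
Proof.
move=> cF; elim: r => [|i r IHr].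
  under eq_fun do rewrite big_nil; exact: cst_continuous.
under eq_fun do rewrite big_cons.
by move=> x; apply: cvgD; [exact: cF|exact: IHr].
Qed.

Lemma continuous_quadratic_term (T : topologicalType) (c : R) (f g : T -> R) :
  continuous f -> continuous g -> continuous (fun x => c * f x * g x).
Proof.
move=> cf cg x; apply: (@cvgM _ _ _ _ (fun x => c * f x) g); last exact: cg.
by apply: (@cvgM _ _ _ _ (fun=> c) f); [exact: cvg_cst|exact: cf].
Qed.

(** Near 0 the linear term dominates: at [t = - b / (|p| + 1)] the expression is negative unless
    [b = 0]. *)
Lemma linear_term_eq0 (b p : R) : (forall t, 0 <= t * b + t ^+ 2 * p) -> b = 0.
Proof.
move=> pos; apply/eqP; case: (eqVneq b 0) => // b_neq0.
have q_gt0 : 0 < `|p| + 1 by rewrite ltr_wpDl.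
have := pos (- b / (`|p| + 1)).
have -> : - b / (`|p| + 1) * b + (- b / (`|p| + 1)) ^+ 2 * p
   = (b / (`|p| + 1)) ^+ 2 * (p - (`|p| + 1)).
  by field; rewrite gt_eqF.
rewrite pmulr_rge0; last by rewrite exprn_even_gt0 //= mulf_neq0 // invr_neq0 ?gt_eqF.
by have := ler_norm p; lra.
Qed.

Section Pencil.
Variables (N : nat) (a : 'I_N -> 'I_N -> R) (d : 'I_N -> R).
Hypothesis a_sym : forall i j, a i j = a j i.
Hypothesis d_gt0 : forall i, 0 < d i.

Let B (x y : 'rV[R]_N) := \sum_i \sum_j a i j * x ord0 i * y ord0 j.
Let D (x y : 'rV[R]_N) := \sum_i d i * x ord0 i * y ord0 i.

Let D_term_ge0 (x : 'rV[R]_N) i : 0 <= d i * x ord0 i * x ord0 i.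
Proof. by rewrite -mulrA -expr2 mulr_ge0 ?sqr_ge0 // ltW. Qed.

Let B0 : B 0 0 = 0.
Proof. by apply: big1 => i _; apply: big1 => j _; rewrite mxE ?(mulr0, mul0r). Qed.

Let D0 : D 0 0 = 0.
Proof. by apply: big1 => i _; rewrite mxE ?(mulr0, mul0r). Qed.

(** By homogeneity it suffices to maximize [B] on the ellipsoid [D x x = 1], which is compact
    because all [d i] are positive. *)
Lemma rayleigh_max : (exists x : 'rV[R]_N, x != 0) -> exists x : 'rV[R]_N,
  x != 0 /\ exists mu : R,
   (forall y, B y y <= mu * D y y) /\ B x x = mu * D x x.
Proof.
move=> [x0 x0_neq0].
have D_gt0 x : x != 0 -> 0 < D x x.
  move=> x_neq0.
  have [i xi|x_eq0] := pickP (fun i => x ord0 i != 0); last first.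
    by case/eqP: x_neq0; apply/rowP => i; rewrite mxE; have /eqP := x_eq0 i.
  rewrite /D (bigD1 i) //= ltr_wpDr ?sumr_ge0 //.
  by rewrite -mulrA mulr_gt0 // -expr2 exprn_even_gt0.
have BZ t x : B (t *: x) (t *: x) = t ^+ 2 * B x x.
  rewrite /B mulr_sumr; apply: eq_bigr => i _; rewrite mulr_sumr.
  by apply: eq_bigr => j _; rewrite !mxE; ring.
have DZ t x : D (t *: x) (t *: x) = t ^+ 2 * D x x.
  by rewrite /D mulr_sumr; apply: eq_bigr => i _; rewrite !mxE; ring.
have normalize x : x != 0 ->
    D ((Num.sqrt (D x x))^-1 *: x) ((Num.sqrt (D x x))^-1 *: x) = 1.
  move=> /D_gt0 Dx; rewrite DZ exprVn sqr_sqrtr ?ltW // mulVf // gt_eqF //.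
pose A : set 'rV[R]_N := [set x | D x x = 1]%classic.
have coordC (i : 'I_N) : continuous (fun x : 'rV[R]_N => x ord0 i).
  exact: coord_continuous.
have B_cont : continuous (fun x => B x x).
  refine (continuous_sum (F := fun i (x : 'rV[R]_N) => \sum_j a i j * x ord0 i * x ord0 j) _) => i.
  refine (continuous_sum (F := fun j (x : 'rV[R]_N) => a i j * x ord0 i * x ord0 j) _) => j x.
  exact: (continuous_quadratic_term (coordC _) (coordC _)).
have D_cont : continuous (fun x => D x x).
  refine (continuous_sum (F := fun i (x : 'rV[R]_N) => d i * x ord0 i * x ord0 i) _) => i x.
  exact: (continuous_quadratic_term (coordC _) (coordC _)).
have A_closed : topology_structure.closed A.
  rewrite (_ : A = (fun x => D x x) @^-1` [set 1])%classic //.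
  by apply: preimage_closed => [x _|]; [exact: D_cont|exact: closed_eq].
have A_bounded : bounded_set A.
  (* On [A] each coordinate satisfies [d j * x_j ^ 2 <= 1], hence [x_j ^ 2 <= C]; bounding [|x_j|]
     by [1 + C] avoids a square root. *)
  pose C := \sum_i (d i)^-1.
  exists (1 + C); split => [|M CM x /= Ax]; first exact: num_real.
  have dV i : 0 <= (d i)^-1 by rewrite invr_ge0 ltW.
  have C_ge0 : 0 <= C by apply: sumr_ge0.
  apply: le_trans (ltW CM); rewrite /Num.norm /= mx_normrE.
  apply: bigmax_le => [|[i j] _ /=]; first by lra.
  rewrite ord1.
  have le_C : x ord0 j ^+ 2 <= C.
    apply: (@le_trans _ _ (d j)^-1); last first.
      by rewrite /C (bigD1 j) //= lerDl sumr_ge0.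
    rewrite -[leRHS]mulr1 ler_pdivlMl // -Ax /D (bigD1 j) //= expr2 mulrA lerDl.
    by apply: sumr_ge0 => k _; exact: D_term_ge0.
  rewrite -real_normK ?num_real // in le_C.
  by have := normr_ge0 (x ord0 j); nra.
have [|||z zA zmax] := @EVT_max_rV R N (fun x => B x x) A.
- by eexists; apply: normalize x0_neq0.
- exact: bounded_closed_compact.
- exact: continuous_subspaceT.
have {}zA : D z z = 1 by exact: set_mem zA.
exists z; split.
  apply: contra_eq_neq zA => ->; rewrite D0 eq_sym; exact: oner_neq0.
exists (B z z); split=> [y|]; last by rewrite zA mulr1.
have [->|y_neq0] := eqVneq y 0.
  by rewrite B0 D0 mulr0.
have /zmax : (Num.sqrt (D y y))^-1 *: y \in A.
  by apply/mem_set; exact: normalize y_neq0.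
have Dy := D_gt0 _ y_neq0; by rewrite BZ exprVn sqr_sqrtr ?(ltW Dy) // ler_pdivrMl // mulrC.
Qed.

(* The maximizer x of the Rayleigh quotient is an eigenvector, by the first
   variation at x in the coordinate directions. *)
Lemma pencil_bound (c : R) :
  (forall (mu : R) (x : 'rV[R]_N), x != 0 ->
     (forall i, \sum_j a i j * x ord0 j = mu * d i * x ord0 i) -> mu <= c) ->
  forall y, B y y <= c * D y y.
Proof.
move=> eigen_le y; have [->|y_neq0] := eqVneq y 0.
  by rewrite B0 D0 mulr0.
have [x [x_neq0 [mu [mu_max mu_x]]]] := rayleigh_max (ex_intro _ y y_neq0).
apply: le_trans (mu_max y) _; apply: ler_wpM2r.
  by apply: sumr_ge0 => i _; exact: D_term_ge0.
apply: (eigen_le mu x x_neq0) => i; apply/eqP.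
rewrite eq_sym -subr_eq0; apply/eqP.
set e : 'rV[R]_N := delta_mx ord0 i.
suff : 2 * (mu * d i * x ord0 i - \sum_j a i j * x ord0 j) = 0.
  by move/eqP; rewrite mulf_eq0 pnatr_eq0 => /orP[//|/eqP].
apply: (@linear_term_eq0 _ (mu * D e e - B e e)) => t.
have Dxe : D (x + t *: e) (x + t *: e) =
    D x x + t * (2 * (d i * x ord0 i)) + t ^+ 2 * D e e.
  have -> : d i * x ord0 i = D x e.
    rewrite /D (bigD1 i) //= big1 => [|k /negPf ki]; rewrite !mxE !eqxx ?ki //=.
      by rewrite mulr1 addr0.
    by rewrite mulr0.
  rewrite /D !mulr_sumr -!big_split /=; apply: eq_bigr => k _; rewrite !mxE; ring.
have Bxe : B (x + t *: e) (x + t *: e) =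
    B x x + t * (2 * (\sum_j a i j * x ord0 j)) + t ^+ 2 * B e e.
  have Bex : \sum_j a i j * x ord0 j = B e x.
    rewrite /B [RHS](bigD1 i) //= [X in _ + X]big1 => [|k /negPf ki].
      by rewrite addr0; apply: eq_bigr => j _; rewrite !mxE !eqxx /= mulr1.
    by apply: big1 => j _; rewrite !mxE ki andbF mulr0 mul0r.
  have Bxe : \sum_j a i j * x ord0 j = B x e.
    rewrite Bex /B exchange_big /=; apply: eq_bigr => j _; apply: eq_bigr => k _.
    by rewrite a_sym; ring.
  have -> : 2 * (\sum_j a i j * x ord0 j) = B x e + B e x.
    by rewrite -Bex -Bxe; ring.
  rewrite mulrDr /B !mulr_sumr -!big_split /=; apply: eq_bigr => k _.
  rewrite !mulr_sumr -!big_split /=; apply: eq_bigr => l _.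
  by rewrite !mxE; ring.
by have := mu_max (x + t *: e); rewrite Dxe Bxe mulrDr mulrDr mu_x -subr_ge0; nra.
Qed.

End Pencil.

(** Transport of [pencil_bound] along the enumeration of [T], so that it applies to functions on the
    vertices of a link. *)
Lemma finite_pencil_bound (T : finType) (a : T -> T -> R) (d : T -> R) (c : R) :
  (forall u v, a u v = a v u) -> (forall v, 0 < d v) ->
  (forall (mu : R) (f : {ffun T -> R}), f != 0 ->
     (forall v, \sum_u a v u * f u = mu * d v * f v) -> mu <= c) ->
  forall f : T -> R,
    \sum_v \sum_u a v u * f v * f u <= c * \sum_v d v * f v ^+ 2.
Proof.
move=> a_sym d_gt0 eigen_le f.
pose e : 'I_#|T| -> T := @enum_val T T.
have reindexT (F : T -> R) : \sum_v F v = \sum_i F (e i).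
  by rewrite (reindex e) //; apply: onW_bij; exact: enum_val_bij.
pose a' i j := a (e i) (e j); pose d' i := d (e i).
pose x : 'rV[R]_#|T| := \row_i f (e i).
have xE i : x ord0 i = f (e i) by rewrite mxE.
rewrite !reindexT (eq_bigr (fun i => \sum_j a' i j * x ord0 i * x ord0 j)).
  rewrite [X in _ <= _ * X](eq_bigr (fun i => d' i * x ord0 i * x ord0 i)).
    apply: pencil_bound => [i j|i|mu y y_neq0 y_eigen]; [exact: a_sym|exact: d_gt0|].
    apply: (eigen_le mu [ffun v => y ord0 (enum_rank v)]).
      apply: contraNneq y_neq0 => y0; apply/eqP/rowP => i.
      by have /ffunP/(_ (e i)) := y0; rewrite !ffunE enum_valK mxE.
    move=> v; rewrite reindexT ffunE; have := y_eigen (enum_rank v).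
    rewrite /a' /d' /e enum_rankK => <-; apply: eq_bigr => i _.
    by rewrite ffunE enum_valK.
  by move=> i _; rewrite xE expr2 mulrA.
by move=> i _; rewrite reindexT; apply: eq_bigr => j _; rewrite !xE.
Qed.

End Spectral.

(** * Balanced weights as sums over facets *)

Section Facets.
Variables (R : realType) (V : finType) (n : nat) (X : {set {set V}}).
Variable m : {set V} -> R.
Hypothesis X_complex : simplicial_complex X.
Hypothesis X_pure : pure X n.
Hypothesis m_balanced : balanced_weight X m n.

Implicit Types (tau s : {set V}) (F G : {set V} -> R) (u v : V).

(** Divided by [facet_sum tau (fun=> 1)], this is the expectation of [F] over a random facet
    conditioned to contain [tau]. It vanishes when [tau] is not a face, so sums over added vertices
    need not be restricted to the link. *)
Definition facet_sum tau F : R :=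
  \sum_(s in simplices X n | tau \subset s) m s * F s.

Local Notation W := facet_sum.
Local Notation w tau := (facet_sum tau (fun=> 1)).

Lemma facet_sumD tau F G : W tau (fun s => F s + G s) = W tau F + W tau G.
Proof. by rewrite -big_split /=; apply: eq_bigr => s _; rewrite mulrDr. Qed.

Lemma facet_sumZ tau a F : W tau (fun s => a * F s) = a * W tau F.
Proof. by rewrite mulr_sumr; apply: eq_bigr => s _; rewrite mulrCA. Qed.

Lemma eq_facet_sum tau F G :
  (forall s, s \in simplices X n -> tau \subset s -> F s = G s) -> W tau F = W tau G.
Proof. by move=> FG; apply: eq_bigr => s /andP[sX ts]; rewrite FG. Qed.

Lemma weight_gt0 s : s \in X -> 0 < m s.
Proof. by case: m_balanced => pos _; exact: pos. Qed.

Lemma facet_in s : s \in simplices X n -> s \in X.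
Proof. by rewrite inE => /andP[]. Qed.

Lemma card_facet s : s \in simplices X n -> #|s| = n.+1.
Proof. by rewrite inE => /andP[_ /eqP]. Qed.

Lemma le_facet_sum tau F G :
  (forall s, s \in simplices X n -> tau \subset s -> F s <= G s) ->
  W tau F <= W tau G.
Proof.
move=> FG; apply: ler_sum => s /andP[sX ts].
by rewrite ler_wpM2l ?FG // ltW // weight_gt0 // facet_in.
Qed.

Lemma facet_sum0 tau : W tau (fun=> 0) = 0.
Proof. by apply: big1 => s _; rewrite mulr0. Qed.

Lemma facet_sum_ge0 tau F :
  (forall s, s \in simplices X n -> tau \subset s -> 0 <= F s) -> 0 <= W tau F.
Proof. by move=> F_ge0; rewrite -(facet_sum0 tau) le_facet_sum. Qed.

Lemma facet_weight_gt0 tau : tau \in X -> 0 < w tau.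
Proof.
move=> /X_pure[s sX ts]; rewrite /facet_sum (bigD1 s) ?sX //= mulr1.
rewrite ltr_wpDr ?weight_gt0 ?facet_in // sumr_ge0 // => t /andP[/andP[tX _] _].
by rewrite mulr1 ltW // weight_gt0 // facet_in.
Qed.

Lemma facet_sum_notin tau F : tau \notin X -> W tau F = 0.
Proof.
move=> tauX; apply: big1 => s /andP[sX ts]; case/negP: tauX.
exact: complex_sub X_complex _ _ (facet_in sX) ts.
Qed.

(** Double counting of the pairs of a facet [s] containing [tau] and a vertex [v] of [s] in [A],
    outside [tau]. *)
Lemma facet_sum_vertices tau (A : {set V}) (F : V -> {set V} -> R) :
  \sum_(v in A :\: tau) W (v |: tau) (F v)
  = W tau (fun s => \sum_(v in (s :\: tau) :&: A) F v s).
Proof.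
rewrite /facet_sum.
rewrite (exchange_big_dep (fun s => (s \in simplices X n) && (tau \subset s))) /=.
  apply: eq_bigr => s /andP[sX ts]; rewrite mulr_sumr.
  apply: eq_bigl => v; rewrite !(in_setI, in_setD) sX subUset sub1set ts.
  by do !case: (_ \in _).
by move=> v s _ /andP[-> /subsetP ts]; apply/subsetP => x xt; rewrite ts // inE xt orbT.
Qed.

Lemma sum_cofaces tau (F : {set V} -> R) :
  \sum_(s in simplices X #|tau| | tau \subset s) F s =
  \sum_(v in ~: tau | v |: tau \in X) F (v |: tau).
Proof.
pose D := [set v in ~: tau | v |: tau \in X].
have D_inj : {in D &, injective (fun v => v |: tau)}.
  move=> u v; rewrite !inE => /andP[u_tau _] _ /setP/(_ u).
  by rewrite /= !inE eqxx (negPf u_tau) !orbF => /esym/eqP.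
transitivity (\sum_(v in D) F (v |: tau)); last by apply: eq_bigl => v; rewrite inE.
rewrite -(big_imset F D_inj) /=; apply: eq_bigl => s.
rewrite !inE; apply/andP/imsetP => [[/andP[sX /eqP card_s] ts]|[v]].
  have : #|s :\: tau| == 1%N.
    by rewrite cardsD (setIidPr ts) card_s subSnn.
  case/cards1P => v sDv; have sE : s = v |: tau.
    by rewrite -[LHS](setID s tau) (setIidPr ts) sDv setUC.
  have: v \in s :\: tau by rewrite sDv set11.
  by rewrite inE => /andP[v_tau _]; exists v; rewrite // !inE v_tau -sE.
by rewrite !inE => /andP[v_tau vX] ->; rewrite vX cardsU1 v_tau subsetUr /=.
Qed.

(** Iterating the balance condition up to the facets adds the vertices of [s :\: tau] one at a time,
    so a facet [s] is reached once for every ordering of [s :\: tau]. *)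
Lemma weight_facet_sum tau : tau \in X -> m tau = (n.+1 - #|tau|)`!%:R * w tau.
Proof.
have card_le t : t \in X -> (#|t| <= n.+1)%N.
  by move=> /X_pure[s /card_facet <- /subset_leq_card].
move: {2}(n.+1 - #|tau|)%N (leqnn (n.+1 - #|tau|)%N) => k.
elim: k tau => [|k IHk] tau tau_k tauX; have tau_le := card_le _ tauX.
  have tau_facet : tau \in simplices X n.
    by rewrite inE tauX /= eqn_leq tau_le //=; lia.
  have -> : (n.+1 - #|tau| = 0)%N by rewrite (card_facet tau_facet) subnn.
  rewrite mul1r /facet_sum (bigD1 tau) ?tau_facet //= mulr1 big1 ?addr0 // => s.
  move=> /andP[/andP[sX ts] /negP[]]; rewrite eq_sym eqEcard ts /=.
  by rewrite (card_facet sX) (card_facet tau_facet).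
(* A facet has no cofaces to sum over, but its codimension is 0 and the induction hypothesis already
   covers it. *)
have [tau_lt|{}tau_le] := ltnP n #|tau|; first by apply: IHk => //; lia.
case: (m_balanced) => _ -> //; rewrite sum_cofaces.
have -> : \sum_(v in ~: tau | v |: tau \in X) m (v |: tau) =
    (n - #|tau|)`!%:R * \sum_(v in setT :\: tau) w (v |: tau).
  rewrite mulr_sumr [RHS](bigID (fun v => v |: tau \in X)) /=.
  rewrite [X in _ = _ + X]big1 ?addr0 => [|v /andP[_ vX]]; last first.
    by rewrite facet_sum_notin ?mulr0.
  apply: eq_big => [v|v /andP[]]; first by rewrite !inE andbT.
  rewrite inE => v_tau vX; have card_v : #|v |: tau| = #|tau|.+1.
    by rewrite cardsU1 v_tau.
  by rewrite IHk // card_v ?subSS //; lia.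
rewrite facet_sum_vertices subSn // factS natrM -mulrA [RHS]mulrCA; congr (_ * _).
rewrite -facet_sumZ; apply: eq_facet_sum => s sX ts; rewrite setIT sumr_const.
by rewrite mulr1 cardsD (setIidPr ts) (card_facet sX) subSn.
Qed.
End Facets.

(** * From the spectrum of a walk to a bound on its quadratic form *)

(* Subtracting d u * d v / M removes the eigenvalue 1 of the constants, so that
   the top of the spectrum of a is a nontrivial eigenvalue of the walk. *)
Lemma walk_gap (R : realType) (T : finType) (e : T -> T -> R) (d : T -> R)
    (lambda : R) :
  (forall u v, e u v = e v u) -> (forall u v, 0 <= e u v) ->
  (forall v, 0 < d v) -> (forall v, \sum_u e v u = d v) ->
  (forall f : T -> R, (forall u v, e u v != 0 -> f u = f v) ->
     forall u v, f u = f v) ->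
  0 <= lambda ->
  (forall (mu : R) (f : {ffun T -> R}), f != 0 ->
     (forall v, \sum_u e v u * f u = mu * d v * f v) -> mu <= lambda \/ mu = 1) ->
  forall f : T -> R, \sum_v d v * f v = 0 ->
  \sum_v \sum_u e v u * f v * f u <= lambda * \sum_v d v * f v ^+ 2.
Proof.
move=> e_sym e_ge0 d_gt0 e_sum connected lambda_ge0 spec f f_mean0.
have d_ge0 v : 0 <= d v by exact: ltW.
pose M := \sum_v d v.
pose a u v := e u v - d u * d v / M.
have aE (g : T -> R) v : \sum_v d v * g v = 0 ->
    \sum_u a v u * g u = \sum_u e v u * g u.
  move=> g_mean0.
  transitivity (\sum_u e v u * g u - d v / M * \sum_u d u * g u); last first.
    by rewrite g_mean0 mulr0 subr0.
  rewrite mulr_sumr -sumrB.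
  by apply: eq_bigr => u _; rewrite /a; ring.
have -> : \sum_v \sum_u e v u * f v * f u = \sum_v \sum_u a v u * f v * f u.
  apply: eq_bigr => v _.
  transitivity (f v * \sum_u e v u * f u).
    by rewrite mulr_sumr; apply: eq_bigr => u _; rewrite mulrCA mulrA.
  by rewrite -aE // mulr_sumr; apply: eq_bigr => u _; rewrite mulrCA mulrA.
apply: finite_pencil_bound => // [u v|mu g g_neq0 g_eigen].
  by rewrite /a e_sym [d u * _]mulrC.
have M_gt0 : 0 < M.
  have [v _|T0] := pickP (@predT T).
    by rewrite /M (bigD1 v) //= ltr_wpDr // sumr_ge0.
  by case/eqP: g_neq0; apply/ffunP => v; have := T0 v.
(* The columns of [a] sum to 0, so pairing the eigenvector equation with the constants gives 0.
   Either [mu = 0], which is at most [lambda], or [g] has mean 0 and is an eigenvector of the walk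
   itself. *)
have : mu * \sum_v d v * g v = 0.
  rewrite mulr_sumr; under eq_bigr do rewrite mulrA -g_eigen.
  rewrite exchange_big big1 //= => u _; rewrite -mulr_suml.
  suff -> : \sum_v a v u = 0 by rewrite mul0r.
  rewrite sumrB -!mulr_suml -/M mulrAC divff ?mul1r ?gt_eqF //.
  by rewrite -e_sum; apply/eqP; rewrite subr_eq0; apply/eqP/eq_bigr => v _.
move/eqP; rewrite mulf_eq0 => /orP[/eqP-> //|/eqP g_mean0].
have {}g_eigen v : \sum_u e v u * g u = mu * d v * g v by rewrite -aE.
case: (spec mu g) => // mu1; case/eqP: g_neq0.
(* For [mu = 1] the Dirichlet form of [g] vanishes; then [g] is constant along edges, hence constant
   by connectedness, and its mean is 0. *)
have energy0 : \sum_v \sum_u e v u * (g v - g u) ^+ 2 = 0.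
  transitivity (\sum_v \sum_u e v u * g v ^+ 2 + \sum_v \sum_u e v u * g u ^+ 2
     - 2 * \sum_v g v * \sum_u e v u * g u).
    rewrite mulr_sumr -big_split -sumrB /=; apply: eq_bigr => v _.
    rewrite !mulr_sumr -big_split -sumrB /=; apply: eq_bigr => u _; ring.
  rewrite [X in _ + X - _]exchange_big /= mulr_sumr -big_split -sumrB big1 //= => v _.
  rewrite g_eigen mu1 -!mulr_suml e_sum; under eq_bigr do rewrite e_sym.
  by rewrite e_sum; ring.
have g_const u v : g u = g v.
  apply: (connected g) => {}u {}v e_uv; apply/eqP; rewrite -subr_eq0 -sqrf_eq0.
  have term_ge0 x y : 0 <= e x y * (g x - g y) ^+ 2 by rewrite mulr_ge0 ?sqr_ge0.
  have /psumr_eq0P/(_ u isT) := energy0.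
  move=> /(_ (fun x _ => sumr_ge0 _ (fun y _ => term_ge0 x y))).
  move/psumr_eq0P => /(_ (fun y _ => term_ge0 u y) v isT) /eqP.
  by rewrite mulf_eq0 (negPf e_uv).
apply/ffunP => v; rewrite ffunE; apply/eqP.
move/eqP: g_mean0; under eq_bigr do rewrite (g_const _ v).
by rewrite -mulr_suml mulf_eq0 gt_eqF.
Qed.

Lemma sum_off_diagonal (R : comPzRingType) (V : finType) (B : {set V}) (f : V -> R) :
  \sum_(v in B) \sum_(u in B :\ v) f v * f u =
  (\sum_(v in B) f v) ^+ 2 - \sum_(v in B) f v ^+ 2.
Proof.
rewrite expr2 mulr_suml -sumrB; apply: eq_bigr => v vB.
by rewrite -mulr_sumr [in RHS](big_setD1 v) //=; ring.
Qed.

(** * The spectral gap of a link as an inequality between facet sums *)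

Section LinkGap.
Variables (R : realType) (V : finType) (n : nat) (X : {set {set V}}).
Variables (m : {set V} -> R) (lambda : R).
Hypothesis X_complex : simplicial_complex X.
Hypothesis X_pure : pure X n.
Hypothesis X_links : connected_links X n.
Hypothesis m_balanced : balanced_weight X m n.
Hypothesis lambda_ge0 : 0 <= lambda.

Implicit Types (tau s : {set V}) (F G : {set V} -> R) (u v : V).

Local Notation W := (facet_sum n X m).
Local Notation w tau := (facet_sum n X m tau (fun=> 1)).

Variable tau : {set V}.
Hypothesis tauX : tau \in X.
Hypothesis tau_lt : (#|tau| < n)%N.
Hypothesis tau_spec : forall mu : R, mu \in upper_walk_spectrum X m tau ->
  mu <= lambda \/ mu = 1.

Lemma mem_link_vertices v :
  (v \in vertices (link X tau)) = (v \in ~: tau) && (v |: tau \in X).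
Proof.
rewrite !inE cards1 eqxx andbT [tau :|: _]setUC cardsU1 addn1.
have [v_tau|] := boolP (v \in tau).
  by rewrite /= add0n ltn_eqF ?andbF // .
move=> _; rewrite /= add1n eqxx andbT.
have [vX|] := boolP (v |: tau \in X); rewrite ?andbF // andbT.
by apply: complex_sub X_complex _ _ vX _; rewrite subsetUl.
Qed.

Lemma link_edgeE u v : v \in ~: tau ->
  ([set u; v] \in simplices (link X tau) 1)
  = (u \in ~: (v |: tau)) && (u |: (v |: tau) \in X).
Proof.
rewrite !inE => v_tau; have -> : tau :|: [set u; v] = u |: (v |: tau).
  by rewrite setUC -setUA.
rewrite cards2 cardsU1 cardsU1 v_tau !inE.
have [->|uv] /= := eqVneq u v; first by rewrite andbF.
have [u_tau|u_tau] /= := boolP (u \in tau).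
  by apply/negbTE; rewrite !negb_and; apply/orP; left; apply/orP; right; lia.
rewrite eqxx andbT (_ : (_ == _) = true) ?andbT; last by lia.
have [uX|] := boolP (u |: (v |: tau) \in X); rewrite ?andbF // andbT.
apply: complex_sub X_complex _ _ uX _.
by rewrite setUA subsetUl.
Qed.

(** Edge weights of the link, extended by 0 to all pairs, and below them its vertex weights [d]. The
    walk maps [phi] to the function [(\sum_u e u v * phi u) / d v] of [v]. *)
Let e u v : R :=
  if [set u; v] \in simplices (link X tau) 1 then m (tau :|: [set u; v]) else 0.
Let d v : R := m (tau :|: [set v]).

Lemma edge_weightE u v : v \in ~: tau ->
  e u v = if u \in ~: (v |: tau) then (n.-1 - #|tau|)`!%:R * w (u |: (v |: tau)) else 0.
Proof.
move=> v_tau; rewrite /e link_edgeE //; case: ifP => [/andP[u_vtau uX]|].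
  rewrite u_vtau setUC -setUA (weight_facet_sum X_complex X_pure m_balanced uX).
  move: v_tau u_vtau; rewrite inE [in _ -> _]inE => v_tau u_vtau.
  by rewrite !cardsU1 u_vtau v_tau /=; congr (_`!%:R * _); lia.
by case: ifP => //= _ /negbT uX; rewrite (facet_sum_notin _ _ X_complex _ uX) mulr0.
Qed.

Lemma link_weightE v : v \in ~: tau -> v |: tau \in X ->
  d v = (n - #|tau|)`!%:R * w (v |: tau).
Proof.
move=> v_tau vX; rewrite /d setUC (weight_facet_sum X_complex X_pure m_balanced vX).
by move: v_tau; rewrite inE => v_tau; rewrite cardsU1 v_tau /=; congr (_`!%:R * _); lia.
Qed.

Lemma sum_link_vertices (F : V -> R) :
  (forall v, v |: tau \notin X -> F v = 0) ->
  \sum_(v : link_vertex X tau) F (val v) = \sum_(v in ~: tau) F v.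
Proof.
move=> F0; rewrite -(big_sub (mem (vertices (link X tau))) F) /=.
rewrite [RHS](bigID (fun v => v |: tau \in X)) /= [X in _ = _ + X]big1.
  by rewrite addr0; apply: eq_bigl => v; rewrite mem_link_vertices.
by move=> v /andP[_ /F0].
Qed.

Lemma link_edge_weight_sym u v : e u v = e v u.
Proof. by rewrite /e setUC. Qed.

Lemma link_edge_weight_notin u v : v \in ~: tau -> u |: tau \notin X -> e u v = 0.
Proof.
move=> v_tau uX; rewrite /e link_edgeE //; case: ifP => // /andP[_ uvX].
case/negP: uX; apply: complex_sub X_complex _ _ uvX _.
by rewrite setUS // subsetUr.
Qed.

(** Weights are positive on faces, so every edge of the link has [e != 0], and [g] is constant along
    paths of the one-skeleton. *)
Lemma link_connected (g : link_vertex X tau -> R) :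
  (forall u v : link_vertex X tau, e (val u) (val v) != 0 -> g u = g v) ->
  forall u v : link_vertex X tau, g u = g v.
Proof.
move=> g_edge u v; pose h x := if insub x is Some y then g y else 0.
have hE y : h (val y) = g y by rewrite /h valK.
have e_neq0 x y : [set x; y] \in simplices (link X tau) 1 -> e x y != 0.
  rewrite /e => xy; rewrite xy; move: xy; rewrite !inE => /andP[/and3P[_ xyX _] _].
  by rewrite gt_eqF // (weight_gt0 m_balanced).
have edge_vertex x y : [set x; y] \in simplices (link X tau) 1 ->
    x \in vertices (link X tau).
  rewrite mem_link_vertices => /setIdP[/setIdP[_ /andP[xyX /eqP card_xy]] /eqP xy2].
  rewrite inE; apply/andP; split; last first.
    apply: complex_sub X_complex _ _ xyX _; rewrite setUC setUS //.
    by rewrite sub1set !inE eqxx.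
  apply/negP => x_tau; have tau_x : tau :|: [set x] = tau.
    by apply/setUidPl; rewrite sub1set.
  move: card_xy; rewrite xy2 setUA tau_x.
  by rewrite setUC cardsU1; case: (_ \notin _); lia.
(* The one-skeleton is a relation on all of [V], so the argument uses a level set of [h], the
   extension of [g] by 0. *)
have h_closed : closed (one_skeleton (link X tau)) [pred x | h x == h (val u)].
  move=> x y /= xy; rewrite !inE.
  have x_vert := edge_vertex _ _ xy.
  have y_vert : y \in vertices (link X tau) by apply: (edge_vertex _ x); rewrite setUC.
  suff -> : h x = h y by [].
  have := g_edge (Sub x x_vert) (Sub y y_vert) (e_neq0 _ _ xy).
  by rewrite -!hE !SubK.
have := closed_connect h_closed (X_links tauX tau_lt (valP u) (valP v)).
by rewrite !inE eqxx => /esym/eqP; rewrite !hE.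
Qed.

(* The difference under the facet sum is the sum of f u * f v over the ordered
   pairs of distinct vertices of s :\: tau, the edges of the link inside s. *)
Lemma link_gap (f : V -> R) :
  W tau (fun s => \sum_(v in s :\: tau) f v) = 0 ->
  W tau (fun s => (\sum_(v in s :\: tau) f v) ^+ 2 - \sum_(v in s :\: tau) f v ^+ 2)
  <= (n - #|tau|)%:R * lambda * W tau (fun s => \sum_(v in s :\: tau) f v ^+ 2).
Proof.
have sumW (F : V -> {set V} -> R) :
    \sum_(v in ~: tau) W (v |: tau) (F v) = W tau (fun s => \sum_(v in s :\: tau) F v s).
  rewrite -setTD facet_sum_vertices; apply: eq_facet_sum => s _ _.
  by rewrite setIT.
move=> f_mean0.
have vT (v : link_vertex X tau) : val v \in ~: tau /\ val v |: tau \in X.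
  by have := valP v; rewrite mem_link_vertices => /andP[].
have d_sum (g : V -> R) : \sum_(v : link_vertex X tau) d (val v) * g (val v)
   = (n - #|tau|)`!%:R * W tau (fun s => \sum_(v in s :\: tau) g v).
  transitivity (\sum_(v : link_vertex X tau)
     (n - #|tau|)`!%:R * W (val v |: tau) (fun=> g (val v))).
    apply: eq_bigr => v _; have [v_tau vX] := vT v.
    rewrite link_weightE // -mulrA; congr (_ * _).
    rewrite mulrC -facet_sumZ; apply: eq_facet_sum => s _ _; exact: mulr1.
  rewrite (sum_link_vertices (F := fun v => (n - #|tau|)`!%:R * W (v |: tau) (fun=> g v))).
    by rewrite -mulr_sumr sumW.
  by move=> v vX; rewrite facet_sum_notin ?mulr0.
have e_sum : \sum_(v : link_vertex X tau) \sum_(u : link_vertex X tau)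
     e (val v) (val u) * f (val v) * f (val u)
   = (n.-1 - #|tau|)`!%:R *
     W tau (fun s => (\sum_(v in s :\: tau) f v) ^+ 2 - \sum_(v in s :\: tau) f v ^+ 2).
  set c : R := _`!%:R.
  pose F v s := \sum_(u in s :\: (v |: tau)) f v * f u.
  transitivity (\sum_(v : link_vertex X tau) c * W (val v |: tau) (F (val v))).
    apply: eq_bigr => v _; have [v_tau vX] := vT v.
    rewrite (sum_link_vertices (F := fun u => e (val v) u * f (val v) * f u)).
      have -> : F (val v) = fun s => \sum_(u in (s :\: (val v |: tau)) :&: setT) f (val v) * f u.
        by apply/boolp.funext => s; rewrite setIT.
      rewrite -(facet_sum_vertices _ _ _ _ _ (fun u s => f (val v) * f u)) mulr_sumr.
      rewrite [LHS](bigID (fun u => u \in ~: (val v |: tau))) /= [X in _ + X]big1 ?addr0.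
        apply: eq_big => [u|u /andP[u_tau u_v]].
          by rewrite !inE andbT; do !case: (_ \in _) => //=; rewrite ?andbF ?andbT ?orbT.
        rewrite link_edge_weight_sym edge_weightE // u_v -2!mulrA; congr (_ * _).
        rewrite mulrC -facet_sumZ; apply: eq_facet_sum => s _ _; exact: mulr1.
      move=> u /andP[u_tau /negPf u_v].
      by rewrite link_edge_weight_sym edge_weightE // u_v !mul0r.
    by move=> u uX; rewrite link_edge_weight_sym link_edge_weight_notin // !mul0r.
  rewrite (sum_link_vertices (F := fun v => c * W (v |: tau) (F v))).
    rewrite -mulr_sumr sumW; congr (_ * _); apply: eq_facet_sum => s _ _.
    rewrite -sum_off_diagonal; apply: eq_bigr => v _; apply: eq_bigl => u.
    by rewrite !inE negb_or andbA.
  by move=> v vX; rewrite facet_sum_notin ?mulr0.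
have gap : \sum_(v : link_vertex X tau) \sum_(u : link_vertex X tau)
     e (val v) (val u) * f (val v) * f (val u)
   <= lambda * \sum_(v : link_vertex X tau) d (val v) * f (val v) ^+ 2.
  apply: (@walk_gap R (link_vertex X tau) (fun v u : link_vertex X tau => e (val v) (val u))
    (fun v : link_vertex X tau => d (val v)) lambda _ _ _ _ _ _ _
    (fun v : link_vertex X tau => f (val v))) => //.
  - by move=> u v; exact: link_edge_weight_sym.
  - move=> u v; rewrite /e; case: ifP => //; rewrite !inE => /andP[/and3P[_ uvX _] _].
    by rewrite ltW // (weight_gt0 m_balanced).
  - by move=> v; have [_ vX] := vT v; rewrite /d setUC (weight_gt0 m_balanced).
  (* The rows of [e] sum to [d] by the balance of [m] at [v |: tau], which has at most [n] vertices
     since [#|tau| < n]. *)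
  - move=> v; have [v_tau vX] := vT v.
    rewrite (sum_link_vertices (F := e (val v))) => [|u uX]; last first.
      by rewrite link_edge_weight_sym link_edge_weight_notin.
    rewrite /d setUC; case: (m_balanced) => _ -> //; last first.
      by move: v_tau; rewrite inE cardsU1 => ->.
    rewrite sum_cofaces // big_mkcond [RHS]big_mkcond; apply: eq_bigr => u _.
    rewrite link_edge_weight_sym /e link_edgeE // [tau :|: _]setUC -setUA.
    by rewrite !inE negb_or; do !case: (_ \in _) => //=; rewrite ?andbF.
  - move=> g g_edge u v; exact: link_connected.
  - move=> mu g g_neq0 g_eigen; apply: tau_spec.
    apply/upper_walk_spectrumP; exists g => //; apply/ffunP => v.
    rewrite !ffunE; have [v_tau vX] := vT v.
    have dv : d (val v) != 0 by rewrite gt_eqF // /d setUC (weight_gt0 m_balanced).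
    apply: (mulfI dv); rewrite /GRing.scale /= mulrCA mulrA -g_eigen mulr_sumr.
    rewrite big_mkcond; apply: eq_bigr => u _; rewrite link_edge_weight_sym /e; case: ifP => _.
      by rewrite mulrA /link_weight mulrCA divff // mulr1.
    by rewrite mul0r.
  - by rewrite d_sum f_mean0 mulr0.
move: gap; rewrite e_sum (d_sum (fun v => f v ^+ 2)).
(* Vertex weights carry the factorial of [n - #|tau|] and edge weights that of [n.-1 - #|tau|];
   their quotient is the factor [n - #|tau|] of the bound. *)
set j := (n.-1 - #|tau|)%N; have -> : (n - #|tau| = j.+1)%N by lia.
have factor (q : R) :
    lambda * ((j.+1 * j`!)%:R * q) = j`!%:R * (j.+1%:R * lambda * q).
  by rewrite natrM; ring.
by rewrite factS factor ler_pM2l // ltr0n fact_gt0.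
Qed.
End LinkGap.

(** * Covariances of events on different sides *)

Section Mixing.
Variables (R : realType) (V : finType) (n : nat) (X : {set {set V}}).
Variables (m : {set V} -> R) (S : 'I_n.+1 -> {set V}) (lambda : R).
Hypothesis X_complex : simplicial_complex X.
Hypothesis X_pure : pure X n.
Hypothesis X_links : connected_links X n.
Hypothesis m_balanced : balanced_weight X m n.
Hypothesis X_partite : partite X S.
Hypothesis lambda_ge0 : 0 <= lambda.
Hypothesis X_spec : forall tau, tau \in X -> (#|tau| < n)%N ->
  forall mu : R, mu \in upper_walk_spectrum X m tau -> mu <= lambda \/ mu = 1.

Implicit Types (tau s : {set V}) (F G : {set V} -> R) (u v : V) (f g : V -> R).
Implicit Types (i j : 'I_n.+1) (J : seq 'I_n.+1).

Local Notation W := (facet_sum n X m).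
Local Notation w tau := (facet_sum n X m tau (fun=> 1)).

(** On a facet this is the value of [f] at the vertex of side [i]; the form of a sum avoids choosing
    that vertex and suits [facet_sum_vertices]. *)
Definition color_sum i f s : R := \sum_(v in s :&: S i) f v.

Lemma color_sumP s i : s \in simplices X n ->
  exists2 v, v \in S i & forall f, color_sum i f s = f v.
Proof.
move=> sX; case: X_partite => _ _ /(_ s sX i)/eqP/cards1P[v sv].
exists v => [|f]; last by rewrite /color_sum sv big_set1.
have : v \in s :&: S i by rewrite sv set11.
  by rewrite inE => /andP[].
Qed.

Lemma color_disjoint i j v : v \in S i -> i != j -> v \notin S j.
Proof. by case: X_partite => dis _ _ vi /dis/disjointFr ->. Qed.

Lemma color_sum_sqr s i f : s \in simplices X n ->
  color_sum i (fun v => f v ^+ 2) s = color_sum i f s ^+ 2.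
Proof. by case/(color_sumP i) => v _ cs; rewrite !cs. Qed.

Lemma color_sumB s i f (a : R) : s \in simplices X n ->
  color_sum i (fun v => f v - a) s = color_sum i f s - a.
Proof. by case/(color_sumP i) => v _ cs; rewrite !cs. Qed.

Lemma color_sumZ s i f (a : R) :
  color_sum i (fun v => a * f v) s = a * color_sum i f s.
Proof. by rewrite /color_sum mulr_sumr. Qed.

(** The law of total expectation over the vertex of side [j], which lies outside [tau] by
    disjointness. *)
Lemma condition_color tau j f F : [disjoint tau & S j] ->
  W tau (fun s => color_sum j f s * F s) = \sum_(v in S j) f v * W (v |: tau) F.
Proof.
move=> tau_j; have -> : \sum_(v in S j) f v * W (v |: tau) F =
    \sum_(v in S j :\: tau) f v * W (v |: tau) F.
  by rewrite (setDidPl _) // disjoint_sym.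
under eq_bigr do rewrite -facet_sumZ.
rewrite (facet_sum_vertices _ _ _ _ _ (fun v s => f v * F s)).
apply: eq_facet_sum => s sX ts; rewrite mulr_suml; apply: eq_bigl => v.
rewrite !inE; have [vj|] := boolP (v \in S j); rewrite ?andbF //.
by rewrite (disjointFl tau_j vj) !andbT.
Qed.

Section Pair.
Variables (tau : {set V}) (i j : 'I_n.+1).
Hypothesis tauX : tau \in X.
Hypothesis tau_lt : (#|tau| < n)%N.
Hypothesis ij : i != j.
Hypothesis tau_i : [disjoint tau & S i].
Hypothesis tau_j : [disjoint tau & S j].

(** Apply [link_gap] to the function [phi] equal to [f] on [S i], to [g] on [S j] and to 0
    elsewhere: on a facet, the square of its sum minus the sum of its squares is twice the product
    of the two values. *)
Lemma centered_pair_bound f g :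
  W tau (color_sum i f) = 0 -> W tau (color_sum j g) = 0 ->
  2 * W tau (fun s => color_sum i f s * color_sum j g s) <=
  (n - #|tau|)%:R * lambda *
    (W tau (fun s => color_sum i f s ^+ 2) + W tau (fun s => color_sum j g s ^+ 2)).
Proof.
move=> f0 g0.
pose phi v := (if v \in S i then f v else 0) + (if v \in S j then g v else 0).
have restrict l (h : V -> R) s : [disjoint tau & S l] ->
    \sum_(v in s :\: tau) (if v \in S l then h v else 0) = color_sum l h s.
  move=> tau_l; rewrite -big_mkcondr; apply: eq_bigl => v.
  rewrite !inE; have [vl|] := boolP (v \in S l); rewrite ?andbF //.
  by rewrite (disjointFl tau_l vl).
have sum_phi s : \sum_(v in s :\: tau) phi v = color_sum i f s + color_sum j g s.
  by rewrite big_split /= !restrict.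
have sum_phi2 s : s \in simplices X n ->
    \sum_(v in s :\: tau) phi v ^+ 2 = color_sum i f s ^+ 2 + color_sum j g s ^+ 2.
  move=> sX; rewrite -!color_sum_sqr // -!restrict // -big_split /=.
  apply: eq_bigr => v _; rewrite /phi; have [vi|_] := boolP (v \in S i).
    by rewrite (negPf (color_disjoint vi ij)) !addr0.
  by case: ifP => _; rewrite !add0r // expr0n.
have := link_gap X_complex X_pure X_links m_balanced lambda_ge0 tauX tau_lt
  (X_spec tauX tau_lt) (f := phi).
rewrite (eq_facet_sum m (fun s _ _ => sum_phi s)) facet_sumD f0 g0 addr0.
rewrite (eq_facet_sum m (fun s sX _ => sum_phi2 s sX)) -facet_sumD => /(_ erefl).
move/(le_trans _); apply; rewrite -facet_sumZ le_eqVlt; apply/orP; left; apply/eqP.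
by apply: eq_facet_sum => s sX _; rewrite sum_phi sum_phi2 //; ring.
Qed.

(** Subtracting the conditional means makes [f] and [g] centered, keeps their covariance and does
    not increase their second moments. *)
Lemma pair_bound_unweighted f g :
  2 * (W tau (fun s => color_sum i f s * color_sum j g s) -
       W tau (color_sum i f) * W tau (color_sum j g) / w tau) <=
  (n - #|tau|)%:R * lambda *
    (W tau (fun s => color_sum i f s ^+ 2) + W tau (fun s => color_sum j g s ^+ 2)).
Proof.
have w_gt0 := facet_weight_gt0 X_pure m_balanced tauX.
have w_neq0 : w tau != 0 by rewrite gt_eqF.
pose a := W tau (color_sum i f) / w tau; pose b := W tau (color_sum j g) / w tau.
have centered l h c F : W tau (fun s => color_sum l (fun v => h v - c) s * F s)
    = W tau (fun s => color_sum l h s * F s) - c * W tau F.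
  rewrite -mulNr -facet_sumZ -facet_sumD; apply: eq_facet_sum => s sX _.
  by rewrite color_sumB //; ring.
have W1 l (h : V -> R) : W tau (color_sum l h) = W tau (fun s => color_sum l h s * 1).
  by apply: eq_facet_sum => s _ _; rewrite mulr1.
have mean0 l (h : V -> R) :
    W tau (color_sum l (fun v => h v - W tau (color_sum l h) / w tau)) = 0.
  by rewrite W1 centered -W1 divfK ?subrr.
have sqr_le l (h : V -> R) :
    W tau (fun s => color_sum l (fun v => h v - W tau (color_sum l h) / w tau) s ^+ 2)
    <= W tau (fun s => color_sum l h s ^+ 2).
  set c := _ / _; have -> : W tau (fun s => color_sum l (fun v => h v - c) s ^+ 2) =
      W tau (fun s => color_sum l (fun v => h v - c) s * color_sum l (fun v => h v - c) s).
    by apply: eq_facet_sum => s _ _; rewrite expr2.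
  rewrite centered mean0 mulr0 subr0.
  have -> : W tau (fun s => color_sum l h s * color_sum l (fun v => h v - c) s) =
      W tau (fun s => color_sum l (fun v => h v - c) s * color_sum l h s).
    by apply: eq_facet_sum => s _ _; rewrite mulrC.
  rewrite centered; have -> : W tau (fun s => color_sum l h s ^+ 2) =
      W tau (fun s => color_sum l h s * color_sum l h s).
    by apply: eq_facet_sum => s _ _; rewrite expr2.
  by rewrite gerBl /c mulrAC -expr2 divr_ge0 ?sqr_ge0 ?ltW.
have := centered_pair_bound (mean0 i f) (mean0 j g).
rewrite centered mean0 mulr0 subr0.
have -> : W tau (fun s => color_sum i f s * color_sum j (fun v => g v - b) s) =
    W tau (fun s => color_sum j (fun v => g v - b) s * color_sum i f s).
  by apply: eq_facet_sum => s _ _; rewrite mulrC.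
rewrite centered (_ : b * _ = W tau (color_sum i f) * W tau (color_sum j g) / w tau).
  2: by rewrite /b; ring.
have -> : W tau (fun s => color_sum j g s * color_sum i f s) =
    W tau (fun s => color_sum i f s * color_sum j g s).
  by apply: eq_facet_sum => s _ _; rewrite mulrC.
move/le_trans; apply; apply: ler_wpM2l; first by rewrite mulr_ge0.
by apply: lerD; exact: sqr_le.
Qed.

(** Scaling [f] by the square root of [t] and [g] by its inverse produces the weights; a change of
    sign of [g] produces the absolute value. *)
Lemma pair_bound f g (t : R) : 0 < t ->
  `| W tau (fun s => color_sum i f s * color_sum j g s) -
     W tau (color_sum i f) * W tau (color_sum j g) / w tau | <=
  (n - #|tau|)%:R * lambda *
    (t * W tau (fun s => color_sum i f s ^+ 2) +
     t^-1 * W tau (fun s => color_sum j g s ^+ 2)) / 2.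
Proof.
move=> t_gt0; pose r := Num.sqrt t.
have r_gt0 : 0 < r by rewrite sqrtr_gt0.
have r2 : r ^+ 2 = t by rewrite sqr_sqrtr // ltW.
have scaled (a : R) : a ^+ 2 = 1 -> a *
   (W tau (fun s => color_sum i f s * color_sum j g s) -
     W tau (color_sum i f) * W tau (color_sum j g) / w tau) <=
  (n - #|tau|)%:R * lambda *
    (t * W tau (fun s => color_sum i f s ^+ 2) +
     t^-1 * W tau (fun s => color_sum j g s ^+ 2)) / 2.
  move=> a2; have := pair_bound_unweighted (fun v => r * f v) (fun v => (a / r) * g v).
  have -> : W tau (fun s => color_sum i (fun v => r * f v) s *
      color_sum j (fun v => a / r * g v) s)
      = a * W tau (fun s => color_sum i f s * color_sum j g s).
    rewrite -facet_sumZ; apply: eq_facet_sum => s _ _; rewrite !color_sumZ.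
    by field; rewrite gt_eqF.
  have WZ l (c : R) h : W tau (color_sum l (fun v => c * h v)) = c * W tau (color_sum l h).
    by rewrite -facet_sumZ; apply: eq_facet_sum => s _ _; rewrite color_sumZ.
  have WZ2 l (c : R) h : W tau (fun s => color_sum l (fun v => c * h v) s ^+ 2)
      = c ^+ 2 * W tau (fun s => color_sum l h s ^+ 2).
    by rewrite -facet_sumZ; apply: eq_facet_sum => s _ _; rewrite color_sumZ exprMn.
  rewrite !WZ !WZ2 expr_div_n a2 r2 div1r.
  have -> : r * W tau (color_sum i f) * (a / r * W tau (color_sum j g)) =
     a * (W tau (color_sum i f) * W tau (color_sum j g)).
    by field; rewrite gt_eqF.
  by rewrite -mulrA -mulrBr; lra.
rewrite ler_norml; apply/andP; split.
  have := scaled (- 1); rewrite sqrrN expr1n mulN1r => /(_ erefl); lra.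
by have := scaled 1; rewrite expr1n mul1r => /(_ erefl).
Qed.

End Pair.

Variable U : 'I_n.+1 -> {set V}.

(** On facets, [hit i] is the indicator of the event that the vertex of side [i] lies in [U i], and
    [hits J] that of the joint event for the sides in [J]. *)
Definition hit i s : R := color_sum i (fun v => (v \in U i)%:R) s.

Definition hits J s : R := \prod_(i <- J) hit i s.

Lemma hit_bool i s : s \in simplices X n -> exists b : bool, hit i s = b%:R.
Proof. by rewrite /hit => /(color_sumP i)[v _ ->]; exists (v \in U i). Qed.

Lemma hits_bool J s : s \in simplices X n -> exists b : bool, hits J s = b%:R.
Proof.
move=> sX; rewrite /hits; elim: J => [|i J [b IHJ]].
  by exists true; rewrite big_nil.
by have [c hc] := hit_bool i sX; exists (c && b); rewrite big_cons hc IHJ -natrM mulnb.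
Qed.

Lemma hits_ge0 J tau : 0 <= W tau (hits J).
Proof.
apply: (facet_sum_ge0 m_balanced) => s sX _.
by have [b ->] := hits_bool J sX; rewrite ler0n.
Qed.

Lemma hits_le_hit i J tau : W tau (hits (i :: J)) <= W tau (hit i).
Proof.
apply: (le_facet_sum m_balanced) => s sX _; rewrite /hits big_cons -/(hits J s).
have [b ->] := hits_bool J sX; have [c ->] := hit_bool i sX.
by rewrite -natrM ler_nat; case: b c => -[].
Qed.

(** The induction on [J] moves one side out of [J] and one vertex into [tau], which preserves the
    bound on [#|tau| + size J]; with [J] nonempty this bound gives the [#|tau| < n] required by
    [pair_bound]. *)
Lemma covariance_bound i J tau (t : R) : 0 < t -> tau \in X ->
  uniq (i :: J) -> (forall j, j \in i :: J -> [disjoint tau & S j]) ->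
  (#|tau| + size J <= n)%N ->
  `| W tau (hits (i :: J)) - W tau (hit i) * W tau (hits J) / w tau | <=
  (n * size J)%:R * lambda * (t * W tau (hit i) + t^-1 * W tau (hits J)) / 2.
Proof.
move=> t_gt0; elim: J tau => [|j J IHJ] tau tauX iJ_uniq tau_iJ tau_J.
  have hits0 s : hits [::] s = 1 by rewrite /hits big_nil.
  have hits1 s : hits [:: i] s = hit i s by rewrite /hits big_seq1.
  rewrite (eq_facet_sum m (fun s _ _ => hits0 s)) (eq_facet_sum m (fun s _ _ => hits1 s)).
  rewrite mulfK ?gt_eqF ?(facet_weight_gt0 X_pure m_balanced) //.
  by rewrite subrr normr0 muln0 !mul0r.
have tau_lt : (#|tau| < n)%N by move: tau_J => /=; lia.
have [ij iJ jJ J_uniq] : [/\ i != j, i \notin J, j \notin J & uniq J].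
  by move: iJ_uniq; rewrite /= inE negb_or => /and3P[/andP[]].
have tau_i : [disjoint tau & S i] by rewrite tau_iJ ?mem_head.
have tau_j : [disjoint tau & S j] by rewrite tau_iJ // !inE eqxx orbT.
(* The conditional probability of j :: J being hit, given the vertex v of side
   j; it is 0 / 0 = 0 if v |: tau is not a face. *)
pose h v := (v \in U j)%:R * (W (v |: tau) (hits J) / w (v |: tau)).
have condition F : W tau (fun s => hit j s * F s) =
    \sum_(v in S j) (v \in U j)%:R * W (v |: tau) F by exact: condition_color.
have hw v : h v * w (v |: tau) = (v \in U j)%:R * W (v |: tau) (hits J).
  have [vX|vX] := boolP (v |: tau \in X); last by rewrite !facet_sum_notin // !mulr0.
  by rewrite /h -mulrA divfK // gt_eqF // (facet_weight_gt0 X_pure m_balanced).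
have h_ge0 v : 0 <= h v.
  by rewrite mulr_ge0 ?ler0n // divr_ge0 ?hits_ge0 // (facet_sum_ge0 m_balanced) => [].
have h_le1 v : h v <= 1.
  have q_le1 : W (v |: tau) (hits J) / w (v |: tau) <= 1.
    have [vX|vX] := boolP (v |: tau \in X).
      rewrite ler_pdivrMr ?(facet_weight_gt0 X_pure m_balanced) // mul1r.
      apply: (le_facet_sum m_balanced) => s sX _.
      by have [b ->] := hits_bool J sX; rewrite lern1 leq_b1.
    by rewrite facet_sum_notin // mul0r.
  by rewrite /h; case: (v \in U j); rewrite ?mul1r // mul0r.
have W_h : W tau (color_sum j h) = W tau (hits (j :: J)).
  transitivity (W tau (fun s => color_sum j h s * 1)).
    by apply: eq_facet_sum => s _ _; rewrite mulr1.
  rewrite condition_color //; under eq_bigr do rewrite hw.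
  by rewrite -condition; apply: eq_facet_sum => s _ _; rewrite /hits big_cons.
have W_ih : W tau (fun s => color_sum i (fun v => (v \in U i)%:R) s * color_sum j h s) =
    \sum_(v in S j) h v * W (v |: tau) (hit i).
  by rewrite -condition_color //; apply: eq_facet_sum => s _ _; rewrite mulrC.
(* The covariance of [hit i] with [h], the conditional expectation of [hits (j :: J)] given the
   vertex of side [j]. *)
have near_pair := pair_bound tauX tau_lt ij tau_i tau_j
  (fun v => (v \in U i)%:R) h t_gt0.
rewrite W_ih W_h -/(hit i) in near_pair.
have W_iJ : W tau (hits [:: i, j & J]) =
    \sum_(v in S j) (v \in U j)%:R * W (v |: tau) (hits (i :: J)).
  by rewrite -condition; apply: eq_facet_sum => s _ _; rewrite /hits !big_cons mulrCA.
(* The conditional covariances, summed over the vertex [v] of side [j]: the induction hypothesis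
   applies if [v |: tau] is a face, and the other terms vanish. *)
have near_links : `| W tau (hits [:: i, j & J]) - \sum_(v in S j) h v * W (v |: tau) (hit i) |
    <= (n * size J)%:R * lambda * (t * W tau (hit i) + t^-1 * W tau (hits (j :: J))) / 2.
  set c := (n * size J)%:R * lambda.
  have c_ge0 : 0 <= c by rewrite mulr_ge0.
  apply: (@le_trans _ _ (\sum_(v in S j) (v \in U j)%:R *
    (c * (t * W (v |: tau) (hit i) + t^-1 * W (v |: tau) (hits J)) / 2))).
    rewrite W_iJ -sumrB; apply: le_trans (ler_norm_sum _ _ _) _.
    apply: ler_sum => v vj.
    have [vX|vX] := boolP (v |: tau \in X); last first.
      by rewrite !facet_sum_notin // !mulr0 subrr normr0 addr0 mulr0 mul0r mulr0.
    have -> : h v * W (v |: tau) (hit i) = (v \in U j)%:R *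
        (W (v |: tau) (hit i) * W (v |: tau) (hits J) / w (v |: tau)).
      by rewrite /h; ring.
    rewrite -mulrBr normrM ger0_norm ?ler0n // ler_wpM2l ?ler0n //.
    apply: IHJ => //.
    - by rewrite /= iJ J_uniq.
    - move=> k k_iJ; have jk : j != k.
        by apply: contraTneq k_iJ => <-; rewrite inE negb_or eq_sym ij jJ.
      rewrite disjoints_subset subUset sub1set inE (color_disjoint vj jk) -disjoints_subset.
      rewrite tau_iJ //.
      by move: k_iJ; rewrite !inE => /orP[->|->]; rewrite ?orbT.
    - have v_tau : v \notin tau by rewrite (disjointFl tau_j vj).
      by rewrite cardsU1 v_tau add1n addSnnS.
  (* Summation over [v] turns the first term into the mass of hitting both [i] and [j], at most that
     of hitting [i]. *)
  have -> : \sum_(v in S j) (v \in U j)%:R *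
      (c * (t * W (v |: tau) (hit i) + t^-1 * W (v |: tau) (hits J)) / 2) =
      c * (t * W tau (fun s => hit j s * hit i s) + t^-1 * W tau (hits (j :: J))) / 2.
    rewrite -W_h condition.
    have -> : W tau (color_sum j h) = \sum_(v in S j) (v \in U j)%:R * W (v |: tau) (hits J).
      by rewrite W_h -condition; apply: eq_facet_sum => s _ _; rewrite /hits big_cons.
    rewrite !mulr_sumr -big_split /= mulr_sumr mulr_suml.
    by apply: eq_bigr => v _; ring.
  rewrite ler_pM2r ?invr_gt0 // ler_wpM2l // lerD2r ler_pM2l //.
  apply: (le_facet_sum m_balanced) => s sX _.
  have [a ->] := hit_bool j sX; have [b ->] := hit_bool i sX.
  by rewrite -natrM ler_nat; case: a b => -[].
(* Both functions take values in [0, 1] on facets, so their second moments are at most their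
   means. *)
have c'_le : (n - #|tau|)%:R * lambda * (t * W tau (fun s => hit i s ^+ 2) +
     t^-1 * W tau (fun s => color_sum j h s ^+ 2)) / 2 <=
   n%:R * lambda * (t * W tau (hit i) + t^-1 * W tau (hits (j :: J))) / 2.
  have t_ge0 := ltW t_gt0; have tV_ge0 : 0 <= t^-1 by rewrite invr_ge0.
  have sqr_i : W tau (fun s => hit i s ^+ 2) <= W tau (hit i).
    apply: (le_facet_sum m_balanced) => s sX _.
    by have [b ->] := hit_bool i sX; case: b; rewrite ?expr1n // expr0n.
  have sqr_j : W tau (fun s => color_sum j h s ^+ 2) <= W tau (hits (j :: J)).
    rewrite -W_h; apply: (le_facet_sum m_balanced) => s sX _.
    have [v _ ->] := color_sumP j sX.
    by rewrite expr2 ler_piMr.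
  have sqr_ge0 F : 0 <= W tau (fun s => F s ^+ 2).
    by apply: (facet_sum_ge0 m_balanced) => s _ _; exact: sqr_ge0.
  rewrite ler_pM2r ?invr_gt0 //; apply: ler_pM.
  - by rewrite mulr_ge0.
  - by rewrite addr_ge0 // mulr_ge0.
  - by rewrite ler_wpM2r // ler_nat leq_subr.
  - by rewrite lerD // ler_wpM2l.
rewrite mulnS natrD.
have := ler_normD (W tau (hits [:: i, j & J]) - \sum_(v in S j) h v * W (v |: tau) (hit i))
  (\sum_(v in S j) h v * W (v |: tau) (hit i) - W tau (hit i) * W tau (hits (j :: J)) / w tau).
rewrite subrKA => /le_trans; apply.
apply: le_trans (lerD near_links (le_trans near_pair c'_le)) _.
by rewrite -mulrDl -mulrDl -mulrDl addrC.
Qed.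

End Mixing.

(** * Two numerical inequalities: optimization of the weight and size of the constant *)

(** For positive [a] and [b] the best weight is the square root of [b / a]. If one of them is 0 no
    weight is optimal, and [t] tends to infinity or to 0 instead. *)
Lemma le_sqrt_of_weighted_amgm (R : rcfType) (a b c x : R) :
  0 <= a -> 0 <= b -> 0 <= c ->
  (forall t, 0 < t -> x <= c * (t * a + t^-1 * b) / 2) -> x <= c * Num.sqrt (a * b).
Proof.
move=> a_ge0 b_ge0 c_ge0 bound.
have vanish (q : R) : 0 <= q -> (forall t, 0 < t -> x <= t * q) -> x <= 0.
  move=> q_ge0 small; rewrite leNgt; apply/negP => x_gt0.
  have q1 : 0 < q + 1 by lra.
  have := small (x / (q + 1)) (divr_gt0 x_gt0 q1).
  rewrite mulrAC ler_pdivlMr // -subr_ge0; nra.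
have [a0|a_neq0] := eqVneq a 0.
  rewrite a0 mul0r sqrtr0 mulr0; apply: (vanish (c * b)); first by rewrite mulr_ge0.
  move=> t t_gt0; have := bound t^-1; rewrite invr_gt0 => /(_ t_gt0).
  by rewrite a0 invrK; have := mulr_ge0 (ltW t_gt0) (mulr_ge0 c_ge0 b_ge0); nra.
have [b0|b_neq0] := eqVneq b 0.
  rewrite b0 mulr0 sqrtr0 mulr0; apply: (vanish (c * a)); first by rewrite mulr_ge0.
  move=> t t_gt0; have := bound t t_gt0.
  by rewrite b0; have := mulr_ge0 (ltW t_gt0) (mulr_ge0 c_ge0 a_ge0); nra.
have sa : 0 < Num.sqrt a by rewrite sqrtr_gt0 lt_neqAle eq_sym a_neq0.
have sb : 0 < Num.sqrt b by rewrite sqrtr_gt0 lt_neqAle eq_sym b_neq0.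
have := bound (Num.sqrt b / Num.sqrt a) (divr_gt0 sb sa).
rewrite sqrtrM // -{2}[a]sqr_sqrtr // -{3}[b]sqr_sqrtr //.
by congr (_ <= _); field; rewrite !gt_eqF.
Qed.

(** The term [k = 0] equals [n * (n + 1) ^ n * (2 ^ n - 1)], where [2 ^ n - 1 >= n] and
    [(n + 1) ^ n >= n + 1]; the other terms are nonnegative. *)
Lemma mixing_const_ge (R : realType) (n : nat) : (1 <= n)%N ->
  (n * n * n.+1)%:R <= mixing_const R n.
Proof.
case: n => // n _; rewrite /mixing_const big_ord_recl /= ler_wpDr //.
  apply: sumr_ge0 => k _; rewrite !mulr_ge0 ?invr_ge0 ?exprn_ge0 //.
  rewrite [(n.+1 - _ + 1)%N]addn1 exprS -mulrBr mulr_ge0 // subr_ge0.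
  by rewrite lerXn2r ?nnegrE // ler_nat; lia.
rewrite !subn0 subn1 add0n !addn1 mul1r expr1n factS !natrM add0n /=.
have fact_neq0 : n`!%:R != 0 :> R by rewrite pnatr_eq0 -lt0n fact_gt0.
have -> : (n.+1)%:R * n`!%:R * (n.+2%:R ^+ n.+1 / n`!%:R) = n.+1%:R * n.+2%:R ^+ n.+1 :> R.
  by field.
have pow2 : n.+1%:R <= 2 ^+ n.+1 - 1 :> R.
  by rewrite lerBrDr natr1 -natrX ler_nat ltn_expl.
rewrite -!mulrA ler_wpM2l // mulrC ler_pM //.
by rewrite exprS ler_peMr // exprn_ege1 // ler1n.
Qed.

(** * From covariances to the deviation from the product of probabilities *)

Section Assembly.
Variables (R : realType) (V : finType) (n : nat) (X : {set {set V}}).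
Variables (m : {set V} -> R) (S : 'I_n.+1 -> {set V}) (lambda : R).
Hypothesis X_complex : simplicial_complex X.
Hypothesis X_pure : pure X n.
Hypothesis X_links : connected_links X n.
Hypothesis m_balanced : balanced_weight X m n.
Hypothesis X_partite : partite X S.
Hypothesis lambda_ge0 : 0 <= lambda.
Hypothesis X_spec : forall tau, tau \in X -> (#|tau| < n)%N ->
  forall mu : R, mu \in upper_walk_spectrum X m tau -> mu <= lambda \/ mu = 1.
Variable U : 'I_n.+1 -> {set V}.
Hypothesis U_sub : forall i, U i \subset S i.

Local Notation W := (facet_sum n X m).
Local Notation w tau := (facet_sum n X m tau (fun=> 1)).

Local Notation hit := (hit R S U).
Local Notation hits := (hits R S U).

(** The probability that a random facet, chosen proportionally to its weight, hits [U i] for all [i]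
    in [J]. *)
Definition prob (J : seq 'I_n.+1) : R := W set0 (hits J) / w set0.

Let p i := prob [:: i].

Let w_gt0 : 0 < w set0.
Proof. by rewrite (facet_weight_gt0 X_pure m_balanced) ?(complex_set0 X_complex). Qed.

Lemma prob_ge0 J : 0 <= prob J.
Proof. by rewrite divr_ge0 ?(ltW w_gt0) // (hits_ge0 m_balanced X_partite). Qed.

Lemma prob_le1 J : prob J <= 1.
Proof.
rewrite ler_pdivrMr // mul1r; apply: (le_facet_sum m_balanced) => s sX _.
by have [b ->] := hits_bool R X_partite U J sX; rewrite lern1 leq_b1.
Qed.

Lemma hits_seq1 i s : hits [:: i] s = hit i s.
Proof. by rewrite /hits big_seq1. Qed.

Lemma prob_cons_le i J : prob (i :: J) <= p i.
Proof.
rewrite /p /prob ler_pM2r ?invr_gt0 // (eq_facet_sum m (fun s _ _ => hits_seq1 i s)).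
exact: hits_le_hit.
Qed.

(** The covariance bound at the empty face holds for every [t]; optimizing [t] gives the square
    root. As [i :: J] has no repetition, [size J <= n], whence the factor [n * n]. *)
Lemma prob_cons_bound i J : uniq (i :: J) ->
  `| prob (i :: J) - p i * prob J | <= (n * n)%:R * lambda * Num.sqrt (p i * prob J).
Proof.
move=> iJ_uniq.
have J_le : (size J <= n)%N.
  by have := uniq_leq_size iJ_uniq (fun k _ => mem_enum 'I_n.+1 k); rewrite /= size_enum_ord ltnS.
apply: le_sqrt_of_weighted_amgm; rewrite ?prob_ge0 ?mulr_ge0 // => t t_gt0.
have := covariance_bound X_complex X_pure X_links m_balanced X_partite lambda_ge0 X_spec U
  t_gt0 (complex_set0 X_complex) iJ_uniq.
rewrite cards0 add0n => cov.
have {cov J_le} : `| W set0 (hits (i :: J)) - W set0 (hit i) * W set0 (hits J) / w set0 |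
   <= (n * n)%:R * lambda * (t * W set0 (hit i) + t^-1 * W set0 (hits J)) / 2.
  apply: le_trans (cov _ J_le) _ => [k _|]; first by rewrite disjoints_subset sub0set.
  rewrite ler_pM2r ?invr_gt0 // ler_wpM2r ?ler_wpM2r ?ler_nat ?leq_mul2l ?J_le ?orbT //.
  have hit_ge0 : 0 <= W set0 (hit i).
    by rewrite -(eq_facet_sum m (fun s _ _ => hits_seq1 i s)) (hits_ge0 m_balanced X_partite).
  by rewrite addr_ge0 // mulr_ge0 ?invr_ge0 ?(ltW t_gt0) // (hits_ge0 m_balanced X_partite).
rewrite /p /prob (eq_facet_sum m (fun s _ _ => hits_seq1 i s)).
have w_neq0 : w set0 != 0 by rewrite gt_eqF.
set A := W set0 _; set B := W set0 _; set C := W set0 _ => cov.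
have -> : A / w set0 - B / w set0 * (C / w set0) = (A - B * C / w set0) / w set0.
  by field.
rewrite normrM normfV (gtr0_norm w_gt0) ler_pdivrMr //.
apply: le_trans cov _; rewrite le_eqVlt; apply/orP; left; apply/eqP.
by field; rewrite w_neq0 gt_eqF.
Qed.

Lemma prob_cons_telescope i J : uniq (i :: J) ->
  `| prob (i :: J) - \prod_(k <- i :: J) p k | <=
  (n * n)%:R * lambda * Num.sqrt (p i * prob J) + p i * `| prob J - \prod_(k <- J) p k |.
Proof.
move=> iJ_uniq; rewrite big_cons.
have -> : prob (i :: J) - p i * \prod_(k <- J) p k =
    (prob (i :: J) - p i * prob J) + p i * (prob J - \prod_(k <- J) p k) by ring.
apply: le_trans (ler_normD _ _) _; rewrite normrM (ger0_norm (prob_ge0 [:: i])).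
by rewrite lerD2r prob_cons_bound.
Qed.

(** Telescoping with every square root bounded by 1; this suffices for the sides that remain once
    two chosen ones are split off. *)
Lemma prob_deviation J : uniq J ->
  `| prob J - \prod_(k <- J) p k | <= (n * n * size J)%:R * lambda.
Proof.
elim: J => [|i J IHJ] iJ_uniq.
  rewrite big_nil /prob (eq_facet_sum m (G := fun=> 1)) ?divff ?gt_eqF //.
    by rewrite subrr normr0 muln0 mul0r.
  by move=> s _ _; rewrite /hits big_nil.
apply: le_trans (prob_cons_telescope iJ_uniq) _.
have {}IHJ : `| prob J - \prod_(k <- J) p k | <= (n * n * size J)%:R * lambda.
  by apply: IHJ; case/andP: iJ_uniq.
rewrite mulnS natrD mulrDl; apply: lerD; last first.
  by apply: le_trans IHJ; rewrite ler_piMl // prob_le1.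
rewrite ler_piMr ?mulr_ge0 // -sqrtr1 ler_wsqrtr //.
by rewrite mulr_ile1 ?prob_ge0 ?prob_le1.
Qed.

(** Splitting off [i], then [j], makes the factor [sqrt (p i * p j)] available in every error term:
    in the first by monotonicity of [prob], in the later ones through the factors [p i] and [p j] of
    the telescoping. *)
Lemma prob_mixing i j : i != j ->
  `| prob (enum 'I_n.+1) - \prod_k p k | <=
  (n * n * n.+1)%:R * lambda * Num.sqrt (p i * p j).
Proof.
move=> ij; pose r := rem j (rem i (enum 'I_n.+1)).
have perm_r : perm_eq (enum 'I_n.+1) [:: i, j & r].
  have i_in : i \in enum 'I_n.+1 by rewrite mem_enum.
  apply: perm_trans (perm_to_rem i_in) _.
  rewrite perm_cons perm_to_rem // (rem_filter i (enum_uniq _)) mem_filter /=.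
  by rewrite eq_sym ij mem_enum.
have r_uniq : uniq [:: i, j & r] by rewrite -(perm_uniq perm_r) enum_uniq.
have r_size : (size r).+2 = n.+1 by move/perm_size: perm_r; rewrite size_enum_ord => /esym.
have jr_uniq : uniq (j :: r) by case/andP: r_uniq.
have -> : prob (enum 'I_n.+1) = prob [:: i, j & r].
  congr (_ / _); apply: eq_facet_sum => s _ _; exact: perm_big.
have -> : \prod_k p k = \prod_(k <- [:: i, j & r]) p k.
  by rewrite -(perm_big _ perm_r) /= big_enum.
apply: le_trans (prob_cons_telescope r_uniq) _.
have dev := prob_deviation (proj2 (andP jr_uniq)).
have tele := prob_cons_telescope jr_uniq.
have sqrt_le1 (x : R) : x <= 1 -> Num.sqrt x <= 1.
  by move=> x_le1; rewrite -sqrtr1 ler_wsqrtr.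
have [pi_ge0 pj_ge0] : 0 <= p i /\ 0 <= p j by split; exact: prob_ge0.
have bound_ij : Num.sqrt (p i * prob (j :: r)) <= Num.sqrt (p i) * Num.sqrt (p j).
  by rewrite -sqrtrM // ler_wsqrtr // ler_wpM2l // prob_cons_le.
have bound_j : Num.sqrt (p j * prob r) <= Num.sqrt (p j).
  by rewrite ler_wsqrtr // ler_piMr // prob_le1.
(* The coefficients [p i] and [p j] become [a ^ 2] and [b ^ 2], which are at most [a] and [b]. *)
rewrite [X in _ <= _ * X]sqrtrM // -{2}(sqr_sqrtr pi_ge0); rewrite -{2}(sqr_sqrtr pj_ge0) in tele.
set a := Num.sqrt (p i) in bound_ij *; set b := Num.sqrt (p j) in bound_ij bound_j tele *.
have [a_ge0 b_ge0] : 0 <= a /\ 0 <= b by rewrite !sqrtr_ge0.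
have [a_le1 b_le1] : a <= 1 /\ b <= 1 by rewrite !sqrt_le1 // prob_le1.
set c := (n * n)%:R * lambda in tele *.
have c_ge0 : 0 <= c by rewrite mulr_ge0.
have {}dev : `| prob r - \prod_(k <- r) p k | <= c * (size r)%:R.
  by apply: le_trans dev _; rewrite natrM mulrAC.
(* One unit of [c] for [i], one for [j] and one for each side in [r] add up to [n.+1]. *)
have -> : (n * n * n.+1)%:R * lambda * (a * b) = c * (a * b) * (2 + (size r)%:R).
  by rewrite natrM /c (_ : n.+1%:R = 2 + (size r)%:R); [ring | rewrite -natrD add2n r_size].
set x := `| prob r - _ | in dev tele; set y := `| prob (j :: r) - _ | in tele *.
have y_le : y <= c * b * (1 + (size r)%:R).
  apply: le_trans tele _; rewrite mulrDr mulr1; apply: lerD.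
    by rewrite ler_wpM2l.
  apply: (@le_trans _ _ (b * (c * (size r)%:R))).
    apply: ler_pM; [exact: sqr_ge0|exact: normr_ge0| |exact: dev].
    by rewrite expr2 ler_piMr.
  by rewrite mulrA [b * c]mulrC.
have -> : c * (a * b) * (2 + (size r)%:R) = c * (a * b) + a * (c * b * (1 + (size r)%:R)).
  by ring.
apply: lerD; first by rewrite ler_wpM2l.
apply: ler_pM; [exact: sqr_ge0|exact: normr_ge0| |exact: y_le].
by rewrite expr2 ler_piMr.
Qed.

(** A vertex has codimension [n], so its weight is [n!] times its facet sum; this factor cancels in
    the ratios of vertex masses. *)
Lemma vertex_mass_color_sum i (A : {set V}) : A \subset S i ->
  vertex_mass m A = n`!%:R * W set0 (color_sum S i (fun v => (v \in A)%:R)).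
Proof.
move=> AS; rewrite /vertex_mass /mass big_imset /=; last by move=> u v _ _ /set1_inj.
have -> : W set0 (color_sum S i (fun v => (v \in A)%:R)) =
    W set0 (fun s => color_sum S i (fun v => (v \in A)%:R) s * 1).
  by apply: eq_facet_sum => s _ _; rewrite mulr1.
rewrite condition_color; last by rewrite disjoints_subset sub0set.
rewrite mulr_sumr big_mkcond [RHS]big_mkcond; apply: eq_bigr => v _.
have [vA|_] := boolP (v \in A); last by case: ifP => _; rewrite // mul0r mulr0.
have vS := subsetP AS v vA; rewrite vS mul1r setU0.
have vX : [set v] \in X.
  have : v \in vertices X by case: X_partite => _ -> _; apply/bigcupP; exists i.
  by rewrite !inE => /andP[].
by rewrite (weight_facet_sum X_complex X_pure m_balanced vX) cards1 subSS subn0.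
Qed.

Lemma vertex_mass_ratio i : vertex_mass m (U i) / vertex_mass m (S i) = p i.
Proof.
rewrite (vertex_mass_color_sum (U_sub i)) (vertex_mass_color_sum (subxx (S i))).
rewrite -mulf_div divff ?mul1r ?pnatr_eq0 -?lt0n ?fact_gt0 //.
congr (_ / _); apply: eq_facet_sum => s sX _; first by rewrite hits_seq1.
by have [v vS ->] := color_sumP R X_partite i sX; rewrite vS.
Qed.

Lemma mass_simplices : mass m (simplices X n) = w set0.
Proof.
by apply: eq_big => [s|s _]; rewrite ?mulr1 // sub0set andbT.
Qed.

Lemma hit_card i s : hit i s = #|s :&: U i|%:R.
Proof.
rewrite -sum1_card natr_sum /hit /color_sum big_mkcond [RHS]big_mkcond.
apply: eq_bigr => v _; rewrite !inE; have [vU|_] := boolP (v \in U i).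
  by rewrite (subsetP (U_sub i) v vU).
by rewrite andbF; case: ifP.
Qed.

(** On a facet each [hit i] is the cardinality of [s :&: U i], which is 0 or 1, so the product is
    the indicator of a transversal. *)
Lemma mass_transversals : mass m (transversals X U) = W set0 (hits (enum 'I_n.+1)).
Proof.
rewrite /mass /facet_sum.
rewrite (eq_bigl (fun s => (s \in simplices X n) && [forall i, #|s :&: U i| == 1%N])); last first.
  by move=> s; rewrite inE.
rewrite [RHS](eq_bigl (fun s => s \in simplices X n)) => [|s]; last by rewrite sub0set andbT.
rewrite big_mkcondr; apply: eq_bigr => s sX; rewrite /hits big_enum /=.
case: ifP => [/forallP all1|/forallPn[i]].
  by rewrite big1 ?mulr1 // => i _; rewrite hit_card (eqP (all1 i)).
have [b] := hit_bool R X_partite U i sX; rewrite (bigD1 i) //= hit_card.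
move=> /eqP; rewrite eqr_nat => /eqP ->.
by case: b => // _; rewrite mul0r mulr0.
Qed.
End Assembly.

(** * Passage to the minimum over pairs of sides *)

Theorem theorem7p3 (R : realType) (V : finType) (n : nat)
    (X : {set {set V}}) (m : {set V} -> R) (S : 'I_n.+1 -> {set V})
    (lambda : R)
    (n_ge1 : (1 <= n)%N)
    (X_complex : simplicial_complex X)
    (X_pure : pure X n)
    (X_links : connected_links X n)
    (m_balanced : balanced_weight X m n)
    (X_partite : partite X S)
    (lambda_gt0 : 0 < lambda) (lambda_lt1 : lambda < 1)
    (X_spec : forall k : nat, (k <= n - 1)%N ->
       forall tau : {set V}, tau \in X -> #|tau| = k ->
       forall mu : R, mu \in upper_walk_spectrum X m tau ->
         -1 <= mu <= lambda \/ mu = 1)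
    (U : 'I_n.+1 -> {set V})
    (U_sub : forall i, U i \subset S i) :
  `| mass m (transversals X U) / mass m (simplices X n)
     - (\prod_i vertex_mass m (U i)) / (\prod_i vertex_mass m (S i)) |
  <= mixing_const R n * lambda *
     min_pairs (fun i j =>
       Num.sqrt ((vertex_mass m (U i) * vertex_mass m (U j)) /
                 (vertex_mass m (S i) * vertex_mass m (S j)))).
Proof.
pose p i := prob X m S U [:: i].
have links_spec tau : tau \in X -> (#|tau| < n)%N ->
    forall mu : R, mu \in upper_walk_spectrum X m tau -> mu <= lambda \/ mu = 1.
  (* With [k = #|tau|], the condition [k <= n - 1] under truncated subtraction follows from
     [#|tau| < n]. *)
  move=> tauX tau_lt mu; have tau_le : (#|tau| <= n - 1)%N by rewrite subn1 -ltnS prednK.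
  by move=> /(X_spec _ tau_le tau tauX erefl)[/andP[_ ?]|?]; [left|right].
have ratio i : vertex_mass m (U i) / vertex_mass m (S i) = p i.
  exact: vertex_mass_ratio.
have -> : (\prod_i vertex_mass m (U i)) / (\prod_i vertex_mass m (S i)) = \prod_i p i.
  by rewrite -prodf_div; apply: eq_bigr => i _; exact: ratio.
rewrite (mass_transversals m X_partite U_sub) mass_simplices.
have const_gt0 : 0 < mixing_const R n.
  by apply: lt_le_trans (mixing_const_ge R n_ge1); rewrite ltr0n !muln_gt0 n_ge1.
have pair_mixing (i j : 'I_n.+1) : (i < j)%N ->
    `| prob X m S U (enum 'I_n.+1) - \prod_k p k | <= mixing_const R n * lambda *
     Num.sqrt ((vertex_mass m (U i) * vertex_mass m (U j)) /
               (vertex_mass m (S i) * vertex_mass m (S j))).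
  move=> ij; rewrite -mulf_div !ratio.
  have neq_ij : i != j by rewrite -val_eqE /= ltn_eqF.
  apply: le_trans (prob_mixing X_complex X_pure X_links m_balanced X_partite
    (ltW lambda_gt0) links_spec U neq_ij) _.
  by rewrite ler_wpM2r ?sqrtr_ge0 // ler_wpM2r ?(ltW lambda_gt0) // mixing_const_ge.
have c_gt0 : 0 < mixing_const R n * lambda by rewrite mulr_gt0.
(* The first goal concerns the initial value of the minimum, at the pair [(0, n)], which is
   increasing because [n >= 1]. *)
rewrite -ler_pdivrMl //; apply: le_bigmin => [|[i j] /= ij].
  by rewrite ler_pdivrMl // pair_mixing.
by rewrite ler_pdivrMl // pair_mixing.
Qed.
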